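(* Let $\alpha>0$ be irrational, let $z_{-1}\in\mathbb{C}$, and let $(z_n)$ be the greedy sequence with parameters $(\alpha,z_{-1})$, with signs $\varepsilon_n$ and ambiguity sequence $a_n$. Let $(p_\ell/q_\ell)_{\ell=1}^\infty$ denote the convergents of the continued fraction expansion of $\alpha$. If for some $k,\ell\in\mathbb{N}$ all the signs $\varepsilon_n$ for $k\le n\le k+q_\ell$ are (defined and) the same, and if $$\min_{k\le n\le k+q_\ell} a_n\ \ge\ \left(4\pi+\frac{4\pi}{|e^{2\pi i\alpha}-1|}\right)\frac{20}{q_\ell},$$ then the sign is constant for all $n\ge k$, i.e. $\varepsilon_n$ is defined and $\varepsilon_n=\varepsilon_k$ for all $n\ge k$.
   Context: Greedy sequence with parameters $(\alpha,z_{-1})$, where $\alpha>0$ is irrational and $z_{-1}\in\mathbb{C}$: for $n\ge 0$, $z_n=z_{n-1}+\varepsilon_n e^{2\pi i\alpha n}$ where the sign $\varepsilon_n\in\{-1,1\}$ is chosen so as to minimize $|z_n|$. If $|z_{n-1}+e^{2\pi i\alpha n}|=|z_{n-1}-e^{2\pi i\alpha n}|$ for some $n$, the sequence terminates at $z_{n-1}$ (neither $z_n$ nor $\varepsilon_n$, nor any later term, is defined). Ambiguity sequence: $a_n=\big||z_{n-1}+e^{2\pi i n\alpha}|-|z_{n-1}-e^{2\pi i n\alpha}|\big|$ for $n\ge 0$. Convergents $p_\ell/q_\ell$ are written in lowest terms with $q_\ell>0$, indexed from $\ell=1$, with $p_1/q_1=\lfloor\alpha\rfloor/1$. *)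

(* Defs.v *)
(* Stdlib reals, with Coquelicot for the complex numbers. *)
From Stdlib Require Export Reals ZArith.
From Coquelicot Require Export Coquelicot.
Open Scope R_scope.

Definition irrational (x : R) : Prop :=
  ~ exists (p q : Z), q <> 0%Z /\ x = IZR p / IZR q.

(* [e2pi x] is $e^{2 \pi i x}$. *)
Definition e2pi (x : R) : C := (cos (2 * PI * x), sin (2 * PI * x)).

(* The sign e in {-1, 1} that minimizes |z + e w|; [None] in case of a tie. *)
Definition greedy_sign (z w : C) : option Z :=
  match total_order_T (Cmod (z + w)) (Cmod (z - w)) with
  | inleft (left _) => Some 1%Z
  | inleft (right _) => None
  | inright _ => Some (-1)%Z
  end.

(* Indices are shifted by one so as to start at 0: [greedy alpha z n] is the
   term $z_{n-1}$ of the greedy sequence with parameters (alpha, z), where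
   $z_{-1} = z$, and [None] once the sequence has terminated. *)
Fixpoint greedy (alpha : R) (z : C) (n : nat) : option C :=
  match n with
  | O => Some z
  | S m =>
      match greedy alpha z m with
      | None => None
      | Some y =>
          let w := e2pi (alpha * INR m) in
          match greedy_sign y w with
          | None => None
          | Some e => Some (y + RtoC (IZR e) * w)%C
          end
      end
  end.

(* The sign $\varepsilon_n$, with no shift of the index. *)
Definition eps (alpha : R) (z : C) (n : nat) : option Z :=
  match greedy alpha z n with
  | None => None
  | Some y => greedy_sign y (e2pi (alpha * INR n))
  end.

(* The ambiguity $a_n$, with no shift of the index; at the index n of a
   terminating tie, where $z_{n-1}$ still exists, it is [Some 0]. *)
Definition ambiguity (alpha : R) (z : C) (n : nat) : option R :=
  match greedy alpha z n with
  | None => None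
  | Some y =>
      let w := e2pi (alpha * INR n) in
      Some (Rabs (Cmod (y + w) - Cmod (y - w)))
  end.

(* The value [b_0; b_1, ..., b_n] of the continued fraction of x truncated after
   n + 1 partial quotients.  For irrational x no divisor vanishes. *)
Fixpoint cf_value (n : nat) (x : R) : R :=
  match n with
  | O => IZR (Zfloor x)
  | S m => IZR (Zfloor x) + 1 / cf_value m (1 / (x - IZR (Zfloor x)))
  end.

(* p/q is, in lowest terms and with q > 0, the l-th convergent of x, where
   convergents are numbered from l = 1, the first one being floor(x)/1. *)
Definition is_convergent (x : R) (l : nat) (p : Z) (q : nat) : Prop :=
  (1 <= l)%nat /\ (0 < q)%nat /\ Z.gcd p (Z.of_nat q) = 1%Z /\
  IZR p / INR q = cf_value (l - 1) x.

(* Main.v *)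
Require Import Defs.
From Stdlib Require Import Lia Lra Psatz.

(** Let [e] be the common sign on the given run and [w_n = e2pi (alpha * n)].
    Along the run the sequence sums a geometric progression, so
    [z_{n-1} = c + e * w_n / (w_1 - 1)] with a fixed centre [c]
    ([constant_sign_circle]).  The greedy rule picks [e] exactly when
    [e * Re (z_{n-1} * conj w_n) < 0], and since [Re (1 / (w_1 - 1)) = -1/2] this
    condition becomes [e * Re (c * conj w_n) < 1/2] ([eps_next_iff]).  As long as
    the run lasts, the next sign thus depends only on the position of [w_n] on
    the circle, through a function of [w_n] with Lipschitz constant [Cmod c].

    The ambiguity bound says that on the first [q] indices of the run this
    inequality holds with a margin larger than [2 * PI * Cmod c * (2 / q)]
    ([ambiguity_margin]).  Since [p / q] is a convergent,
    [Rabs (alpha - p / q) <= 1 / q^2] ([convergent_error]), hence every multiple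
    of [alpha] is within [2 / q] modulo [1] of one of [q] consecutive multiples
    ([rotation_dense]).  The inequality therefore holds at every index [n >= k],
    and strong induction turns it into [eps n = e] for all of them. *)

(** * Rational approximation of the rotation *)

Lemma irrational_frac_pos (x : R) :
  irrational x -> 0 < x - IZR (Zfloor x) < 1.
Proof.
  intros Hx.
  destruct (Zfloor_bound x) as [Hl Hu].
  assert (x <> IZR (Zfloor x)).
  { intros E. apply Hx. exists (Zfloor x), 1%Z. split; [lia|].
    rewrite Rdiv_1_r. exact E. }
  lra.
Qed.

Lemma irrational_inv_frac (x : R) :
  irrational x -> irrational (1 / (x - IZR (Zfloor x))).
Proof.
  intros Hx [a [b [Hb E]]].
  pose proof (irrational_frac_pos x Hx) as Hf.
  apply Hx.
  pose proof (eq_IZR_contrapositive _ _ Hb) as HbR.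
  assert (HaR : IZR a <> 0).
  { intros Ha. rewrite Ha in E. unfold Rdiv in E. rewrite Rmult_0_l in E.
    pose proof (Rinv_0_lt_compat (x - IZR (Zfloor x)) ltac:(lra)). lra. }
  exists (b + Zfloor x * a)%Z, a. split.
  - intros Ha. subst a. apply HaR. reflexivity.
  - rewrite plus_IZR, mult_IZR.
    assert (x - IZR (Zfloor x) = IZR b / IZR a).
    { rewrite <- (Rinv_inv (x - IZR (Zfloor x))).
      unfold Rdiv in E. rewrite Rmult_1_l in E. rewrite E. field. split; lra. }
    replace ((IZR b + IZR (Zfloor x) * IZR a) / IZR a)
      with (IZR b / IZR a + IZR (Zfloor x)) by (field; lra).
    lra.
Qed.

(** Unfolding the continued fraction expresses [x] as the image of the complete
    quotient [y] under a Moebius map of determinant [1] or [-1] whose columns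
    are two successive convergents.  The recursion of [cf_value] peels quotients
    off from the front, so the induction multiplies matrices on the left; the
    positivity of the numerators for [1 < x] is what makes the denominators
    positive one step later. *)
Lemma cf_value_moebius (n : nat) : forall x : R, irrational x ->
  exists (P Q P' Q' : Z) (y : R),
    (1 <= Q)%Z /\ (0 <= Q')%Z /\ (1 < x -> (1 <= P)%Z /\ (0 <= P')%Z) /\
    (Z.abs (P * Q' - P' * Q) = 1)%Z /\ 1 < y /\
    x * (IZR Q * y + IZR Q') = IZR P * y + IZR P' /\
    cf_value n x = IZR P / IZR Q.
Proof.
  induction n as [|n IH]; intros x Hx;
    pose proof (irrational_frac_pos x Hx) as Hf;
    set (b := Zfloor x) in *;
    set (x1 := 1 / (x - IZR b)).
  all: assert (Hx1 : 1 < x1) by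
    (unfold x1, Rdiv; rewrite Rmult_1_l, <- Rinv_1;
     apply Rinv_lt_contravar; lra).
  all: assert (Hxx1 : (x - IZR b) * x1 = 1) by (unfold x1; field; lra).
  all: assert (Hb : 1 < x -> (1 <= b)%Z) by
    (intros H; assert (IZR 0 < IZR b) as H' by lra; apply lt_IZR in H'; lia).
  - exists b, 1%Z, 1%Z, 0%Z, x1.
    repeat split; try lia; try lra.
    + apply Hb; assumption.
    + simpl. fold b. field.
  - destruct (IH x1 (irrational_inv_frac x Hx))
      as (P & Q & P' & Q' & y & HQ & HQ' & HP & Hdet & Hy & Hmoeb & Hval).
    destruct (HP Hx1) as [HP1 HP2].
    exists (b * P + Q)%Z, P, (b * P' + Q')%Z, P', y.
    split; [lia|]. split; [lia|]. split; [|split; [|split; [|split]]].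
    + intros H. specialize (Hb H). nia.
    + rewrite <- Hdet.
      replace ((b * P + Q) * P' - (b * P' + Q') * P)%Z
        with (- (P * Q' - P' * Q))%Z by ring.
      apply Z.abs_opp.
    + exact Hy.
    + rewrite !plus_IZR, !mult_IZR.
      assert ((x - IZR b) * (IZR P * y + IZR P') = IZR Q * y + IZR Q').
      { rewrite <- Hmoeb, <- Rmult_assoc, Hxx1. ring. }
      lra.
    + simpl. fold b. fold x1. rewrite Hval, plus_IZR, mult_IZR.
      apply IZR_le in HQ. apply IZR_le in HP1. field. lra.
Qed.

Lemma convergent_error (x : R) (l : nat) (p : Z) (q : nat) :
  irrational x -> is_convergent x l p q ->
  Rabs (x - IZR p / INR q) <= / (INR q * INR q).
Proof.
  intros Hx (_ & Hq & Hgcd & Hval).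
  destruct (cf_value_moebius (l - 1) x Hx)
    as (P & Q & P' & Q' & y & HQ & HQ' & _ & Hdet & Hy & Hmoeb & Hval').
  rewrite Hval' in Hval. rewrite Hval.
  assert (HqR : 0 < INR q) by (apply lt_0_INR; lia).
  assert (HQR : 1 <= IZR Q) by (apply IZR_le; lia).
  assert (HQR' : 0 <= IZR Q') by (apply IZR_le; lia).
  (* [p/q] is in lowest terms, so [q] divides the denominator [Q]. *)
  assert (HqQ : INR q <= IZR Q).
  { assert (E : (p * Q = P * Z.of_nat q)%Z).
    { apply eq_IZR. rewrite !mult_IZR, <- INR_IZR_INZ.
      apply (Rmult_eq_reg_r (/ (INR q * IZR Q)));
        [|apply Rinv_neq_0_compat; nra].
      transitivity (IZR p / INR q); [field; lra|].
      rewrite Hval. field. lra. }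
    rewrite INR_IZR_INZ. apply IZR_le. apply Z.divide_pos_le; [lia|].
    apply (Z.gauss _ p).
    - exists P. rewrite E. ring.
    - rewrite Z.gcd_comm. exact Hgcd. }
  set (D := IZR Q * y + IZR Q') in *.
  assert (HD : IZR Q <= D) by (unfold D; nra).
  assert (E : x - IZR P / IZR Q = IZR (P' * Q - P * Q') * / (IZR Q * D)).
  { apply (Rmult_eq_reg_r (IZR Q * D)); [|nra].
    rewrite Rmult_assoc, Rinv_l by nra.
    rewrite minus_IZR, !mult_IZR.
    replace ((x - IZR P / IZR Q) * (IZR Q * D))
      with ((x * D) * IZR Q - IZR P * D) by (field; lra).
    rewrite Hmoeb. unfold D. ring. }
  rewrite E, Rabs_mult, <- abs_IZR.
  replace (Z.abs (P' * Q - P * Q'))%Z with 1%Z by lia.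
  rewrite Rmult_1_l, Rabs_pos_eq by (left; apply Rinv_0_lt_compat; nra).
  apply Rinv_le_contravar; nra.
Qed.

(** Modulo [1], the multiples of a reduced fraction [p/q] by [0, ..., q-1] run
    through all multiples of [1/q], and replacing [p/q] by [x] moves each of them
    by at most [1/q]. *)
Lemma rotation_dense (x : R) (p : Z) (q : nat) (s : R) :
  (0 < q)%nat -> Z.gcd p (Z.of_nat q) = 1%Z ->
  Rabs (x - IZR p / INR q) <= / (INR q * INR q) ->
  exists (j : nat) (N : Z),
    (j < q)%nat /\ Rabs (s - (x * INR j + IZR N)) <= 2 / INR q.
Proof.
  intros Hq Hgcd Herr.
  assert (HqR : 0 < INR q) by (apply lt_0_INR; lia).
  set (r := Zfloor (s * INR q)).
  destruct (Zfloor_bound (s * INR q)) as [Hr1 Hr2]. fold r in Hr1, Hr2.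
  (* The index [j] solves [j * p = r] modulo [q]. *)
  destruct (Z.gcd_bezout p (Z.of_nat q) 1 Hgcd) as (a & b & Hab).
  set (jz := ((r * a) mod Z.of_nat q)%Z).
  assert (Hjz : (0 <= jz < Z.of_nat q)%Z) by (apply Z.mod_pos_bound; lia).
  set (N := (r * b + p * ((r * a) / Z.of_nat q))%Z).
  assert (Hr : (r = jz * p + N * Z.of_nat q)%Z).
  { pose proof (Z_div_mod_eq_full (r * a) (Z.of_nat q)) as Hd.
    fold jz in Hd. unfold N.
    replace jz with (r * a - Z.of_nat q * (r * a / Z.of_nat q))%Z by lia.
    transitivity (r * (a * p + b * Z.of_nat q))%Z; [rewrite Hab|]; ring. }
  exists (Z.to_nat jz), N. split; [lia|].
  assert (HjR : INR (Z.to_nat jz) = IZR jz)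
    by (rewrite INR_IZR_INZ, Z2Nat.id by lia; reflexivity).
  rewrite HjR.
  assert (Hj0 : 0 <= IZR jz) by (apply IZR_le; lia).
  assert (Hjq : IZR jz <= INR q) by (rewrite INR_IZR_INZ; apply IZR_le; lia).
  apply (f_equal IZR) in Hr.
  rewrite plus_IZR, !mult_IZR, <- INR_IZR_INZ in Hr.
  set (th := x - IZR p / INR q) in *.
  set (iq := / INR q) in *.
  assert (Hiq : 0 < iq) by (apply Rinv_0_lt_compat; lra).
  assert (Hqi : INR q * iq = 1) by (apply Rinv_r; lra).
  assert (E : s - (x * IZR jz + IZR N) = (s * INR q - IZR r) * iq - IZR jz * th).
  { rewrite Hr. unfold th, iq. field. lra. }
  rewrite E. unfold Rdiv. fold iq.
  rewrite Rinv_mult in Herr. fold iq in Herr.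
  apply Rabs_le_between in Herr.
  apply Rabs_le.
  assert (Hb : - iq <= IZR jz * th <= iq) by nra.
  assert (0 <= (s * INR q - IZR r) * iq <= iq) by nra.
  lra.
Qed.

(** * Points of the circle *)

Definition dot (a b : C) : R := fst a * fst b + snd a * snd b.

Lemma Cmod_sqr (a : C) : Cmod a * Cmod a = fst a * fst a + snd a * snd a.
Proof.
  unfold Cmod. rewrite sqrt_sqrt by nra. ring.
Qed.

Lemma e2pi_sqr (t : R) :
  fst (e2pi t) * fst (e2pi t) + snd (e2pi t) * snd (e2pi t) = 1.
Proof.
  unfold e2pi; simpl. pose proof (sin2_cos2 (2 * PI * t)) as H.
  unfold Rsqr in H. lra.
Qed.

Lemma e2pi_plus (s t : R) : e2pi (s + t) = (e2pi s * e2pi t)%C.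
Proof.
  unfold e2pi, Cmult; simpl.
  rewrite Rmult_plus_distr_l, cos_plus, sin_plus. f_equal. ring.
Qed.

Lemma e2pi_nat (n : nat) : e2pi (INR n) = 1%C.
Proof.
  unfold e2pi.
  replace (2 * PI * INR n) with (0 + 2 * INR n * PI) by ring.
  rewrite cos_period, sin_period, cos_0, sin_0. reflexivity.
Qed.

Lemma e2pi_Z (N : Z) : e2pi (IZR N) = 1%C.
Proof.
  destruct (Z_le_dec 0 N) as [H|H].
  - rewrite <- (Z2Nat.id N H), <- INR_IZR_INZ. apply e2pi_nat.
  - assert (E : IZR N + INR (Z.to_nat (- N)) = 0).
    { rewrite INR_IZR_INZ, Z2Nat.id, <- plus_IZR by lia. f_equal. lia. }
    pose proof (e2pi_plus (IZR N) (INR (Z.to_nat (- N)))) as H1.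
    rewrite E, e2pi_nat, Cmult_1_r in H1.
    rewrite <- H1. exact (e2pi_nat 0).
Qed.

Lemma e2pi_irrational_neq_1 (x : R) : irrational x -> e2pi x <> 1%C.
Proof.
  intros Hx E. apply Hx.
  apply (f_equal fst) in E. simpl in E.
  replace (2 * PI * x) with (2 * (PI * x)) in E by ring.
  rewrite cos_2a_sin in E.
  destruct (sin_eq_0_0 (PI * x)) as [N HN]; [nra|].
  exists N, 1%Z. split; [lia|].
  rewrite Rdiv_1_r. pose proof PI_RGT_0. nra.
Qed.

(** The derivative of [t -> dot c (e2pi t)] is [2 * PI] times the inner product
    of [c] with a unit vector. *)
Lemma dot_e2pi_lipschitz (c : C) (s t : R) :
  Rabs (dot c (e2pi t) - dot c (e2pi s)) <= 2 * PI * Cmod c * Rabs (t - s).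
Proof.
  apply (bounded_variation (fun r => dot c (e2pi r))
    (fun r => 2 * PI * (snd c * cos (2 * PI * r) - fst c * sin (2 * PI * r)))).
  intros r _. split.
  - unfold dot, e2pi; simpl. auto_derive; [trivial|]. ring.
  - pose proof PI_RGT_0. rewrite Rabs_mult, Rabs_pos_eq by lra.
    apply Rmult_le_compat_l; [lra|].
    apply Rsqr_incr_0_var; [|apply Cmod_ge_0].
    rewrite <- Rsqr_abs. unfold Rsqr. rewrite Cmod_sqr.
    pose proof (e2pi_sqr r) as Hcs. unfold e2pi in Hcs; simpl in Hcs.
    set (C1 := cos (2 * PI * r)) in *. set (S1 := sin (2 * PI * r)) in *.
    assert (0 <= (fst c * C1 + snd c * S1) * (fst c * C1 + snd c * S1))
      by (apply Rle_0_sqr).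
    replace (fst c * fst c + snd c * snd c)
      with ((fst c * fst c + snd c * snd c) * (C1 * C1 + S1 * S1))
      by (rewrite Hcs; ring).
    nra.
Qed.

(** * One step of the greedy sequence *)

Lemma Cmod_plus_minus_sqr (y w : C) :
  (Cmod (y + w) - Cmod (y - w)) * (Cmod (y + w) + Cmod (y - w)) = 4 * dot y w.
Proof.
  replace ((Cmod (y + w) - Cmod (y - w)) * (Cmod (y + w) + Cmod (y - w)))
    with (Cmod (y + w) * Cmod (y + w) - Cmod (y - w) * Cmod (y - w)) by ring.
  rewrite !Cmod_sqr. unfold dot; simpl. ring.
Qed.

Lemma greedy_sign_cases (y w : C) (e : Z) :
  greedy_sign y w = Some e -> (e = 1 \/ e = -1)%Z.
Proof.
  unfold greedy_sign. destruct total_order_T as [[]|]; intros H; inversion H; auto.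
Qed.

Lemma greedy_sign_dot (y w : C) (e : Z) :
  (e = 1 \/ e = -1)%Z ->
  greedy_sign y w = Some e <-> IZR e * dot y w < 0.
Proof.
  intros He. pose proof (Cmod_plus_minus_sqr y w) as H.
  pose proof (Cmod_ge_0 (y + w)). pose proof (Cmod_ge_0 (y - w)).
  unfold greedy_sign. destruct total_order_T as [[Hc|Hc]|Hc].
  - assert (dot y w < 0) by nra.
    destruct He; subst e; split; intros; try reflexivity; try discriminate; lra.
  - assert (dot y w = 0) by (rewrite Hc in H; lra).
    split; intros H'; [discriminate|]. rewrite H2 in H'. lra.
  - assert (0 < dot y w) by nra.
    destruct He; subst e; split; intros; try reflexivity; try discriminate; lra.
Qed.

(** The difference of the squares of [Cmod (y + w)] and [Cmod (y - w)] is
    [4 * dot y w], while the parallelogram with sides [y] and [w] has diagonals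
    at least as long in total as twice either side.  So a large ambiguity forces
    [dot y w] away from [0], the more so the larger [y] is. *)
Lemma ambiguity_dot (y w : C) :
  fst w * fst w + snd w * snd w = 1 ->
  exists S : R, 2 <= S /\ 2 * Cmod y <= S /\
    Rabs (Cmod (y + w) - Cmod (y - w)) * S = 4 * Rabs (dot y w).
Proof.
  intros Hw. exists (Cmod (y + w) + Cmod (y - w)).
  pose proof (Cmod_ge_0 (y + w)). pose proof (Cmod_ge_0 (y - w)).
  assert (Hw1 : Cmod w = 1).
  { pose proof (Cmod_sqr w). pose proof (Cmod_ge_0 w). nra. }
  assert (H2 : Cmod 2 = 2) by (rewrite Cmod_R; apply Rabs_pos_eq; lra).
  split; [|split].
  - pose proof (Cmod_triangle (y + w) (- (y - w))) as T.
    replace (y + w + - (y - w))%C with (2 * w)%C in T by ring.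
    rewrite Cmod_mult, Cmod_opp, Hw1, H2 in T. lra.
  - pose proof (Cmod_triangle (y + w) (y - w)) as T.
    replace (y + w + (y - w))%C with (2 * y)%C in T by ring.
    rewrite Cmod_mult, H2 in T. lra.
  - rewrite <- (Rabs_pos_eq (Cmod (y + w) + Cmod (y - w))) at 1 by lra.
    rewrite <- Rabs_mult, Cmod_plus_minus_sqr, Rabs_mult.
    rewrite (Rabs_pos_eq 4) by lra. reflexivity.
Qed.

(** * Runs of a constant sign *)

(** While the sign is [e], the sequence adds terms of a geometric progression of
    ratio [e2pi alpha], so it stays on a circle around a fixed centre. *)
Lemma constant_sign_circle (alpha : R) (z c : C) (e : Z) (k : nat) :
  e2pi alpha <> 1%C ->
  let u := (/ (e2pi alpha - 1))%C in
  greedy alpha z k = Some (c + IZR e * (u * e2pi (alpha * INR k)))%C ->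
  forall d : nat,
  (forall n : nat, (k <= n < k + d)%nat -> eps alpha z n = Some e) ->
  greedy alpha z (k + d) = Some (c + IZR e * (u * e2pi (alpha * INR (k + d))))%C.
Proof.
  intros Hne u Hk d. induction d as [|d IH]; intros Hd.
  - rewrite Nat.add_0_r. exact Hk.
  - rewrite Nat.add_succ_r.
    specialize (IH (fun n Hn => Hd n ltac:(lia))).
    specialize (Hd (k + d)%nat ltac:(lia)).
    unfold eps in Hd. simpl greedy. rewrite IH in Hd |- *.
    rewrite Hd. f_equal.
    rewrite S_INR, Rmult_plus_distr_l, Rmult_1_r, e2pi_plus.
    unfold u. field. intros E. apply Hne.
    replace (e2pi alpha) with (e2pi alpha - 1 + 1)%C by ring.
    rewrite E. ring.
Qed.

(** The constant term comes from the real part of [1 / (v - 1)], which is [-1/2]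
    for every [v <> 1] on the unit circle. *)
Lemma dot_circle (t : R) (c w : C) (e : R) :
  e2pi t <> 1%C -> fst w * fst w + snd w * snd w = 1 ->
  dot (c + e * (/ (e2pi t - 1) * w)) w = dot c w - e / 2.
Proof.
  intros Hne Hw. pose proof (e2pi_sqr t) as Ht.
  destruct (e2pi t) as [C1 S1]. simpl in Ht.
  assert (HD : 0 < (C1 - 1) * (C1 - 1) + S1 * S1).
  { assert (0 <= (C1 - 1) * (C1 - 1)) by nra. assert (0 <= S1 * S1) by nra.
    destruct (Req_dec C1 1) as [E|E]; [|nra].
    assert (S1 = 0) by nra. exfalso. apply Hne. subst. reflexivity. }
  unfold dot, Cplus, Cmult, Cinv, Cminus, RtoC; simpl.
  destruct w as [a b]; simpl in *.
  assert (HR : (C1 - 1) / ((C1 - 1) * (C1 - 1) + S1 * S1) = - / 2).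
  { replace ((C1 - 1) * (C1 - 1) + S1 * S1) with (2 - 2 * C1) by nra.
    field. nra. }
  set (D := (C1 - 1) * (C1 - 1) + S1 * S1) in *.
  replace ((C1 + - (1)) * ((C1 + - (1)) * 1) + (S1 + - 0) * ((S1 + - 0) * 1))
    with D by (unfold D; ring).
  transitivity (fst c * a + snd c * b
    + e * ((C1 - 1) / D) * (a * a + b * b)).
  - field. lra.
  - rewrite HR, Hw. field.
Qed.

Lemma eps_next_iff (alpha : R) (z c : C) (e : Z) (n : nat) :
  e2pi alpha <> 1%C -> (e = 1 \/ e = -1)%Z ->
  greedy alpha z n =
    Some (c + IZR e * (/ (e2pi alpha - 1) * e2pi (alpha * INR n)))%C ->
  eps alpha z n = Some e <-> IZR e * dot c (e2pi (alpha * INR n)) < / 2.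
Proof.
  intros Hne He Hg. unfold eps. rewrite Hg.
  rewrite greedy_sign_dot, (dot_circle _ _ _ _ Hne (e2pi_sqr _)) by exact He.
  destruct He; subst e; split; lra.
Qed.

(** The added term bounds the variation of [dot c] along an arc of [2 / q] turns.
    With [y] the current term and [r = 1 / Cmod (e2pi alpha - 1)] the radius of
    the circle, [ambiguity_dot] makes the gap in [eps_next_iff] at least
    [40 * PI * (Cmod y + r) / q], and [Cmod c <= Cmod y + r] because [y] lies on
    the circle of radius [r] around [c]. *)
Lemma ambiguity_margin (alpha : R) (z c : C) (e : Z) (n : nat) (q a : R) :
  e2pi alpha <> 1%C -> (e = 1 \/ e = -1)%Z -> 0 < q ->
  greedy alpha z n =
    Some (c + IZR e * (/ (e2pi alpha - 1) * e2pi (alpha * INR n)))%C ->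
  eps alpha z n = Some e ->
  ambiguity alpha z n = Some a ->
  (4 * PI + 4 * PI / Cmod (e2pi alpha - 1)) * (20 / q) <= a ->
  IZR e * dot c (e2pi (alpha * INR n)) + 2 * PI * Cmod c * (2 / q) < / 2.
Proof.
  intros Hne He Hq Hg Hs Ha Hle.
  assert (Hlt := proj1 (eps_next_iff _ _ _ _ _ Hne He Hg) Hs).
  unfold ambiguity in Ha. rewrite Hg in Ha.
  set (w := e2pi (alpha * INR n)) in *.
  assert (Hw : fst w * fst w + snd w * snd w = 1) by apply e2pi_sqr.
  pose proof (dot_circle alpha c w (IZR e) Hne Hw) as Hdot.
  assert (Hd0 : (e2pi alpha - 1)%C <> 0%C).
  { intros E. apply Hne.
    replace (e2pi alpha) with (e2pi alpha - 1 + 1)%C by ring.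
    rewrite E. ring. }
  set (r := / Cmod (e2pi alpha - 1)).
  assert (Hr : 0 < r) by (apply Rinv_0_lt_compat, Cmod_gt_0, Hd0).
  unfold Rdiv at 1 in Hle. fold r in Hle.
  assert (Hur : Cmod (IZR e * (/ (e2pi alpha - 1) * w)) = r).
  { rewrite !Cmod_mult, Cmod_inv, Cmod_R by exact Hd0.
    assert (Cmod w = 1).
    { pose proof (Cmod_sqr w). pose proof (Cmod_ge_0 w). nra. }
    rewrite H, <- abs_IZR. fold r.
    destruct He; subst e; simpl; ring. }
  set (v := (IZR e * (/ (e2pi alpha - 1) * w))%C) in *.
  injection Ha as Ha.
  set (y := (c + v)%C) in *.
  assert (Hc : Cmod c <= Cmod y + r).
  { rewrite <- Hur, <- (Cmod_opp v).
    replace c with (y + - v)%C at 1 by (unfold y; ring).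
    apply Cmod_triangle. }
  destruct (ambiguity_dot y w Hw) as (S & HS2 & HSy & HS).
  rewrite Ha, Hdot in HS.
  assert (Hg4 : a * S = 4 * (/ 2 - IZR e * dot c w)).
  { rewrite HS. f_equal. destruct He; subst e.
    - rewrite Rabs_left; lra.
    - rewrite Rabs_pos_eq; lra. }
  pose proof PI_RGT_0 as HPI. pose proof (Cmod_ge_0 y) as Hy0.
  unfold Rdiv in *. assert (Hiq := Rinv_0_lt_compat q Hq).
  set (iq := / q) in *.
  assert (HPq : 0 < PI * iq) by nra.
  assert (H1 : 80 * (PI * iq) * (1 + r) * S <= a * S).
  { apply Rmult_le_compat_r; [lra|].
    replace (80 * (PI * iq) * (1 + r)) with ((4 * PI + 4 * PI * r) * (20 * iq))
      by ring.
    exact Hle. }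
  assert (H2 : 2 * (Cmod y + r) <= (1 + r) * S) by nra.
  assert (H3 : (PI * iq) * (2 * (Cmod y + r)) <= (PI * iq) * ((1 + r) * S))
    by (apply Rmult_le_compat_l; lra).
  assert (H4 : (PI * iq) * Cmod c <= (PI * iq) * (Cmod y + r))
    by (apply Rmult_le_compat_l; lra).
  assert (H5 : 0 < (PI * iq) * (Cmod y + r)) by nra.
  lra.
Qed.

(** * The sign stays constant *)

Theorem theorem2 (alpha : R) (z : C)
    (halpha : 0 < alpha) (hirr : irrational alpha)
    (k l : nat) (p : Z) (q : nat) (hpq : is_convergent alpha l p q)
    (hsame : forall n : nat, (k <= n <= k + q)%nat ->
       eps alpha z n <> None /\ eps alpha z n = eps alpha z k)
    (hmin : forall n : nat, (k <= n <= k + q)%nat ->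
       exists a : R, ambiguity alpha z n = Some a /\
         (4 * PI + 4 * PI / Cmod (e2pi alpha - 1)) * (20 / INR q) <= a) :
  forall n : nat, (k <= n)%nat ->
    eps alpha z n <> None /\ eps alpha z n = eps alpha z k.
Proof.
  pose proof (e2pi_irrational_neq_1 alpha hirr) as Hne.
  pose proof (convergent_error alpha l p q hirr hpq) as Herr.
  destruct hpq as (_ & Hq & Hgcd & _).
  assert (HqR : 0 < INR q) by (apply lt_0_INR; lia).
  destruct (eps alpha z k) as [e|] eqn:Hk;
    [|destruct (hsame k ltac:(lia)); congruence].
  assert (He : (e = 1 \/ e = -1)%Z).
  { unfold eps in Hk. destruct (greedy alpha z k); [|discriminate].
    exact (greedy_sign_cases _ _ _ Hk). }
  assert (Hc : exists c : C, greedy alpha z k =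
    Some (c + IZR e * (/ (e2pi alpha - 1) * e2pi (alpha * INR k)))%C).
  { unfold eps in Hk. destruct (greedy alpha z k) as [y|]; [|discriminate].
    exists (y - IZR e * (/ (e2pi alpha - 1) * e2pi (alpha * INR k)))%C.
    f_equal. ring. }
  destruct Hc as [c Hc].
  pose proof (constant_sign_circle alpha z c e k Hne Hc) as Hcircle.
  cbv zeta in Hcircle.
  assert (Hmargin : forall j : nat, (j < q)%nat ->
    IZR e * dot c (e2pi (alpha * INR (k + j)))
      + 2 * PI * Cmod c * (2 / INR q) < / 2).
  { intros j Hj.
    destruct (hmin (k + j)%nat ltac:(lia)) as (a & Ha & Hle).
    refine (ambiguity_margin alpha z c e (k + j) (INR q) a Hne He HqR _ _ Ha Hle).
    - apply Hcircle. intros n Hn. apply hsame. lia.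
    - apply hsame. lia. }
  assert (Hall : forall d : nat, IZR e * dot c (e2pi (alpha * INR (k + d))) < / 2).
  { intros d.
    destruct (rotation_dense alpha p q (alpha * INR d) Hq Hgcd Herr)
      as (j & N & Hj & Hd).
    specialize (Hmargin j Hj).
    pose proof (dot_e2pi_lipschitz c (alpha * INR (k + j) + IZR N)
                  (alpha * INR (k + d))) as HL.
    rewrite (e2pi_plus _ (IZR N)), e2pi_Z, Cmult_1_r in HL.
    replace (alpha * INR (k + d) - (alpha * INR (k + j) + IZR N))
      with (alpha * INR d - (alpha * INR j + IZR N)) in HL
      by (rewrite !plus_INR; ring).
    pose proof PI_RGT_0 as HPI. pose proof (Cmod_ge_0 c) as Hc0.
    apply (Rmult_le_compat_l (2 * PI * Cmod c)) in Hd; [|nra].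
    pose proof (Rle_trans _ _ _ HL Hd) as HL'.
    apply Rabs_le_between in HL'.
    destruct He; subst e; lra. }
  assert (Heps : forall d : nat, eps alpha z (k + d) = Some e).
  { intros d. induction d as [d IH] using lt_wf_ind.
    apply (eps_next_iff alpha z c e (k + d) Hne He); [|apply Hall].
    apply Hcircle. intros n Hn.
    replace n with (k + (n - k))%nat by lia. apply IH. lia. }
  intros n Hn. replace n with (k + (n - k))%nat by lia.
  rewrite Heps. split; congruence.
Qed.
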